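(* Let $X$ be a locally convex space, let $A:X\rightrightarrows X^{*}$ be representable, and let $C\subset X$ be closed and convex. If $D(A)\cap\operatorname{int}C\neq\emptyset$, then $A+N_{C}$ is representable.
   Context: $X$ is a non-trivial Hausdorff locally convex space with topology $\tau$, $X^{*}$ its dual with weak-star topology $\omega^*$, $Z=X\times X^*$ with topology $\tau\times\omega^*$, $c(x,x^{*})=\langle x,x^{*}\rangle$. Operators are identified with their graphs; $D(A)$ is the domain. $N_C$ is the normal cone: $N_C(x)=\{x^*\mid\langle y-x,x^*\rangle\le0\ \forall y\in C\}$ for $x\in C$, $N_C(x)=\emptyset$ otherwise; $(A+N_C)(x)=Ax+N_C(x)$. $T$ is representable if there is a proper convex $\tau\times\omega^{*}$-lsc $h:Z\to\overline{\mathbb{R}}$ with $h\ge c$ and $\{z\mid h(z)=c(z)\}=\operatorname{Graph}T$. *)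

(* Defs.v *)
From HB Require Import structures.
From mathcomp Require Import all_boot all_order all_algebra.
From mathcomp Require Import all_classical all_reals all_analysis.
Set Implicit Arguments. Unset Strict Implicit. Unset Printing Implicit Defensive.
Import Order.TTheory GRing.Theory Num.Theory.
Import numFieldTopology.Exports.
Local Open Scope classical_set_scope.
Local Open Scope ring_scope.

Section Defs.
Variables (R : realType) (X : tvsType R).

Definition dual : set (X -> R) :=
  [set f | (forall (a : R) (x y : X), f (a *: x + y) = a * f x + f y)
           /\ continuous (f : X -> R)].

(** Ambient type of pairs (x, x^* ), the second component carrying the
    topology of pointwise convergence; restricted to dual this is the
    weak-star topology, so the subspace topology on Zset is tau x omega^*. *)
Definition Ztype : Type := (X * {ptws X -> R})%type.

Definition Zset : set Ztype := [set z | dual z.2].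

Definition coupling (z : Ztype) : R := z.2 z.1.

Definition graph (T : X -> set (X -> R)) : set Ztype := [set z | T z.1 z.2].

Definition domain (T : X -> set (X -> R)) : set X := [set x | T x !=set0].

Definition normal_cone (C : set X) (x : X) : set (X -> R) :=
  [set f | C x /\ dual f /\ forall y, C y -> f (y - x) <= 0].

Definition op_add (A B : X -> set (X -> R)) (x : X) : set (X -> R) :=
  [set h | exists2 f, A x f & exists2 g, B x g & h = (fun y => f y + g y)].

(** convexity of an extended-real function on Z (epigraph convexity) *)
Definition convex_on_Z (h : Ztype -> \bar R) :=
  forall (z1 z2 : Ztype) (a b t : R), Zset z1 -> Zset z2 ->
    0 <= t <= 1 -> (h z1 <= a%:E)%E -> (h z2 <= b%:E)%E ->
    let zt : Ztype := (t *: z1.1 + (1 - t) *: z2.1,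
                       (fun y => t * z1.2 y + (1 - t) * z2.2 y) : {ptws X -> R}) in
    (h zt <= (t * a + (1 - t) * b)%:E)%E.

Definition representable (T : X -> set (X -> R)) :=
  exists h : Ztype -> \bar R,
    (exists2 z, Zset z & (h z < +oo)%E) /\
    (forall z, Zset z -> (h z > -oo)%E) /\
    convex_on_Z h /\
    lower_semicontinuous (h : subspace Zset -> \bar R) /\
    (forall z, Zset z -> ((coupling z)%:E <= h z)%E) /\
    [set z | Zset z /\ h z = (coupling z)%:E] = graph T.

Definition convex_set_X (C : set X) :=
  forall x y (t : R), C x -> C y -> 0 <= t <= 1 -> C (t *: x + (1 - t) *: y).

End Defs.

(* Main.v *)
Require Import Defs.
From HB Require Import structures.
From mathcomp Require Import all_boot all_order all_algebra.
From mathcomp Require Import all_classical all_reals all_analysis.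
From mathcomp Require Import ring lra.
Set Implicit Arguments. Unset Strict Implicit. Unset Printing Implicit Defensive.
Import Order.TTheory GRing.Theory Num.Theory.
Import numFieldNormedType.Exports.
Local Open Scope classical_set_scope.
Local Open Scope ring_scope.

(** Let [h] represent [A] and let [z0 = (x0, x0s)] be in the graph of [A] with
    [x0] interior to [C]. The function
      [k (x, xs) = iota_C x + inf_u (h (x, xs - u) + sigma_C u)]
    dominates the coupling, since [sigma_C u >= u x] on [C], and where the
    infimum is attained it equals the coupling exactly on the graph of
    [A + N_C]. Because [h] touches the coupling at [z0], it has an affine
    minorant whose slope in [xs] is [x0]; as [sigma_C u] exceeds [u x0] by the
    supremum of [u] over the neighbourhood [C - x0] of 0, the sublevel sets in
    [u] are weak-star compact. This gives attainment and lower
    semicontinuity. *)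

(** * Limits of real families along filters and ultrafilters *)

Section Limits.
Context {R : realType} {I : Type}.
Implicit Types (F G : set_system I) (f : I -> R).

Lemma ler_cvg_near F {FF : ProperFilter F} f (l M : R) :
  f @ F --> l -> (\forall i \near F, f i <= M) -> l <= M.
Proof.
by move=> fl fM; apply: (@closed_cvg _ _ F _ f (fun x => x <= M) _ fM l fl);
  exact: closed_le.
Qed.

(** Compactness of [[a, b]] gives a cluster point; an ultrafilter contains each set or its
    complement, so a cluster point is a limit. *)
Lemma ultra_bounded_cvg G {GU : UltraFilter G} f (a b : R) :
  (\forall i \near G, a <= f i <= b) -> exists l : R, f @ G --> l.
Proof.
move=> fab.
have : (f @ G) `[a, b]%classic.
  by near=> i; rewrite /= in_itv /=; near: i.
move=> /segment_compact[l [_ lcl]]; exists l => B Bl.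
have [//|GnB] := in_ultra_setVsetC (f @^-1` B) GU.
by have [x []] := lcl (~` B) B GnB Bl.
Unshelve. all: by end_near. Qed.

End Limits.

(** * Continuous linear functionals and neighbourhoods of 0 *)

Section DualSpace.
Context {R : realType} {X : tvsType R}.
Implicit Types (f g u : X -> R) (x y : X).

Lemma dual0 f : dual f -> f 0 = 0.
Proof. by case=> lf _; have := lf (-1) 0 0; rewrite scaler0 addr0; lra. Qed.

Lemma dualD f x y : dual f -> f (x + y) = f x + f y.
Proof. by case=> lf _; have := lf 1 x y; rewrite scale1r mul1r. Qed.

Lemma dualZ f (a : R) x : dual f -> f (a *: x) = a * f x.
Proof. by move=> df; have := df.1 a x 0; rewrite addr0 dual0 ?addr0. Qed.

Lemma dualN f x : dual f -> f (- x) = - f x.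
Proof. by move=> df; rewrite -scaleN1r dualZ// mulN1r. Qed.

Lemma dual_comb (a b : R) f g : dual f -> dual g ->
  dual (fun y => a * f y + b * g y).
Proof.
move=> [lf cf] [lg cg]; split; first by move=> c x y; rewrite lf lg; ring.
move=> x; apply: cvgD; apply: cvgM; [exact: cvg_cst|exact: cf|
  exact: cvg_cst|exact: cg].
Qed.

Lemma dualB f g : dual f -> dual g -> dual (fun y => f y - g y).
Proof.
move=> df dg; have := dual_comb 1 (-1) df dg.
by congr dual; apply/funext => y; rewrite mul1r mulN1r.
Qed.

Lemma dual_cst0 : dual (fun _ : X => 0 : R).
Proof.
by split; [move=> *; rewrite mulr0 addr0|move=> x; exact: cvg_cst].
Qed.

Lemma scale_sub_cvg0 (a : R) x : (a *: (y - x)) @[y --> x] --> (0 : X).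
Proof.
have sub0 : (y - x) @[y --> x] --> (0 : X).
  have pxx : (y, x) @[y --> x] --> (x, x).
    by apply: cvg_pair; [exact: cvg_id|exact: cvg_cst].
  have := cvg_comp _ _ pxx (@sub_continuous X (x, x)).
  by rewrite /= subrr; exact.
have pa0 : ((a : R^o), y - x) @[y --> x] --> ((a : R^o), (0 : X)).
  by apply: (@cvg_pair _ _ _ _ (nbhs (a : R^o))); [exact: cvg_cst|exact: sub0].
have := cvg_comp _ _ pa0 (@scale_continuous R X (a, 0)).
by rewrite /= scaler0; exact.
Qed.

Lemma nbhs0_absorbing (V : set X) x : nbhs 0 V ->
  exists2 e : R, 0 < e & V (e *: x).
Proof.
move=> V0; have := @scale_continuous R X (0, x).
rewrite /continuous_at /= scale0r => /(_ V V0) [[P Q] /= [P0 Qx] PQ].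
have [e /= e0 eP] : exists2 e : R, 0 < e & P e.
  have : \forall r \near (0:R)^'+, P r by apply: cvg_at_right_filter P0.
  move=> Pr; near (0:R)^'+ => r; exists r; near: r => //.
  exact: nbhs_right_gt.
by exists e => //; apply: (PQ (e, x)); split=> //; exact: nbhs_singleton.
Unshelve. all: by end_near. Qed.

(** A one-sided bound suffices: for [y] near [x], both [a *: (y - x)] and its opposite lie in [V],
    so [a * |u y - u x| <= M]. *)
Lemma linear_bounded_dual u (V : set X) (M : R) :
  (forall (a : R) x y, u (a *: x + y) = a * u x + u y) ->
  nbhs 0 V -> (forall v, V v -> u v <= M) -> dual u.
Proof.
move=> lu V0 uM; split=> // x.
have u0 : u 0 = 0 by have := lu (-1) 0 0; rewrite scaler0 addr0; lra.
have uZ a y : u (a *: y) = a * u y by have := lu a y 0; rewrite addr0 u0 addr0.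
have uB y z : u (y - z) = u y - u z.
  by rewrite addrC -scaleN1r lu mulN1r addrC.
have M0 : 0 <= M by rewrite -u0; apply: uM; exact: nbhs_singleton V0.
(* This choice gives [M < a * e]; the summand 1 keeps [a] positive when [M = 0]. *)
apply/cvgrPdist_lt => e e0; pose a := (M + 1) / e.
have a0 : 0 < a by rewrite divr_gt0//; lra.
have Me : M < a * e by rewrite /a divfK ?gt_eqF//; lra.
near=> y.
have V1 : u (a *: (y - x)) <= M.
  by apply: uM; near: y; exact: (scale_sub_cvg0 _ _ V0).
have V2 : u ((- a) *: (y - x)) <= M.
  by apply: uM; near: y; exact: (scale_sub_cvg0 _ _ V0).
rewrite !uZ uB in V1 V2.
rewrite ltr_norml; apply/andP; split; rewrite -(ltr_pM2l a0); lra.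
Unshelve. all: by end_near. Qed.

End DualSpace.

(** * Affine minorants and the convolution of [h] with the support function of [C] *)

Section Representative.
Context {R : realType} {X : tvsType R}.
Implicit Types (h : Ztype X -> \bar R) (C : set X) (z : Ztype X) (u : X -> R).

Definition zsub z u : Ztype X := (z.1, fun y => z.2 y - u y).

Lemma Zset_zsub z u : Zset z -> dual u -> Zset (zsub z u).
Proof. exact: dualB. Qed.

(* If [h = c] at [z0], dividing [c (t z + (1-t) z0) <= t h z + (1-t) c z0] by
   [t] and letting [t] tend to 0 gives the affine minorant below. *)
Lemma affine_minorant h z0 z (r : R) : convex_on_Z h ->
  (forall w, Zset w -> ((coupling w)%:E <= h w)%E) ->
  Zset z0 -> (h z0 <= (coupling z0)%:E)%E -> Zset z -> (h z <= r%:E)%E ->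
  z0.2 z.1 + z.2 z0.1 - coupling z0 <= r.
Proof.
move=> hconv hc Z0 h0 Z1 h1; rewrite leNgt; apply/negP => rlt.
rewrite /coupling in rlt h0.
set d := z0.2 z.1 + z.2 z0.1 - z0.2 z0.1 in rlt.
set e := z.2 z.1 - d.
have quad t : 0 < t <= 1 -> t * e + d <= r.
  move=> /andP[t0 t1].
  have t01 : 0 <= t <= 1 by rewrite ltW.
  pose zt : Ztype X := (t *: z.1 + (1 - t) *: z0.1,
    fun y => t * z.2 y + (1 - t) * z0.2 y).
  have hzt : (h zt <= (t * r + (1 - t) * z0.2 z0.1)%:E)%E.
    exact: (hconv _ _ _ _ _ Z1 Z0 t01 h1 h0).
  have Zt : Zset zt by exact: dual_comb.
  have := le_trans (hc _ Zt) hzt; rewrite lee_fin /coupling /=.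
  rewrite (dualD _ _ Z1) (dualD _ _ Z0) !(dualZ _ _ Z1) !(dualZ _ _ Z0) => le1.
  rewrite -(ler_pM2l t0) /e /d; move: le1; lra.
(* So small that [t * |e| < d - r], which contradicts [quad]. *)
pose t := Num.min 1 ((d - r) / (2 * (`|e| + 1))).
have den : 0 < 2 * (`|e| + 1) by rewrite mulr_gt0// ltr_wpDl.
have t0 : 0 < t by rewrite lt_min ltr01 divr_gt0// subr_gt0.
have t1 : t <= 1 by rewrite ge_min lexx.
have := quad t; rewrite t0 t1 => /(_ isT).
have tle : t * (2 * (`|e| + 1)) <= d - r.
  by rewrite -ler_pdivlMr// ge_min lexx orbT.
have := ler_norm (- e); rewrite normrN => en.
have : t * - e <= t * `|e| by rewrite ler_pM2l.
nra.
Qed.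

(* [feasible h C z u b] says that [h (z.1, z.2 - u) + sigma_C u <= b], with
   [z.1] in [C], where [sigma_C] is the support function of [C]. *)
Definition feasible h C z u (b : R) : Prop :=
  [/\ C z.1, dual u & forall y, C y -> (h (zsub z u) <= (b - u y)%:E)%E].

(** The infimum of the empty set is [+oo], so the indicator of [C] is built in through
    [feasible]. *)
Definition inf_conv h C z : \bar R :=
  ereal_inf [set b%:E | b in [set b | exists u, feasible h C z u b]].

(* Near a point of the interior of [C] lying in the domain, the minorant bounds
   the feasible functionals above on a neighbourhood of 0, so that they
   converge pointwise along an ultrafilter. *)
Lemma feasible_limit h C z0 (I : Type) (F : set_system I)
    (zf : I -> Ztype X) (uf : I -> X -> R) (bf : I -> R) z (b : R) :
  closed C -> convex_on_Z h ->
  lower_semicontinuous (h : subspace (@Zset R X) -> \bar R) ->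
  (forall w, Zset w -> ((coupling w)%:E <= h w)%E) ->
  Zset z0 -> (h z0 <= (coupling z0)%:E)%E -> nbhs z0.1 C ->
  ProperFilter F -> Zset z ->
  (\forall i \near F, Zset (zf i)) ->
  (\forall i \near F, feasible h C (zf i) (uf i) (bf i)) ->
  (zf i).1 @[i --> F] --> z.1 ->
  (forall x, (zf i).2 x @[i --> F] --> z.2 x) ->
  bf @ F --> b ->
  exists u, feasible h C z u b.
Proof.
move=> Ccl hconv hlsc hc Z0 h0 C0 FP Zz nZ nfeas cz1 cz2 cb.
(* Refining to an ultrafilter keeps the given limits and makes bounded real families converge. *)
have [G [GU FG]] := ultraFilterLemma FP.
have {}nZ := FG _ nZ; have {}nfeas := FG _ nfeas.
have {}cz1 : (zf i).1 @[i --> G] --> z.1 by move=> B /cz1/FG.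
have {}cz2 x : (zf i).2 x @[i --> G] --> z.2 x by move=> B /cz2/FG.
have {}cb : bf @ G --> b by move=> B /cb/FG.
pose V := [set v | C (z0.1 + v)].
have V0 : nbhs 0 V.
  have := @add_continuous X (z0.1, 0); rewrite /continuous_at /= addr0.
  move=> /(_ C C0) [[P Q] /= [P0 Q0] PQ]; apply: filterS Q0 => v Qv.
  by apply: (PQ (z0.1, v)); split=> //; exact: nbhs_singleton.
(* The affine minorant at [zsub (zf i) (uf i)], with feasibility tested at [z0.1 + v], yields
   [uf i v <= bd i]: the terms [uf i z0.1] cancel. *)
pose bd i := bf i - z0.2 (zf i).1 - (zf i).2 z0.1 + coupling z0.
have [M bdM] : exists M, \forall i \near G, bd i <= M.
  exists (b - z0.2 z.1 - z.2 z0.1 + coupling z0 + 1).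
  have cbd : bd @ G --> b - z0.2 z.1 - z.2 z0.1 + coupling z0.
    apply: cvgD; last exact: cvg_cst.
    apply: cvgB; last exact: cz2.
    apply: cvgB => //; exact: (cvg_comp _ _ cz1 (Z0.2 z.1)).
  by near do apply: ltW; apply: cvgr_lt cbd _ _; lra.
have ufM : \forall i \near G, forall v, V v -> uf i v <= M.
  near=> i => v Vv.
  have [Ci di fi] : feasible h C (zf i) (uf i) (bf i) by near: i.
  have Zi : Zset (zf i) by near: i.
  have := affine_minorant hconv hc Z0 h0 (Zset_zsub Zi di) (fi _ Vv).
  have : bd i <= M by near: i.
  by rewrite /bd /= (dualD _ _ di); lra.
(* [V] absorbs both [x] and [- x], which turns the upper bound [M] into a two-sided one. *)
have ufcvg x : exists l : R, uf i x @[i --> G] --> l.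
  have [e1 e10 V1] := nbhs0_absorbing x V0.
  have [e2 e20 V2] := nbhs0_absorbing (- x) V0.
  apply: (@ultra_bounded_cvg _ _ G _ _ (- (M / e2)) (M / e1)).
  near=> i.
  have [_ di _] : feasible h C (zf i) (uf i) (bf i) by near: i.
  have uM : forall v, V v -> uf i v <= M by near: i.
  have := uM _ V1; have := uM _ V2; rewrite !(dualZ _ _ di) (dualN _ di) => le2 le1.
  rewrite lerNl !ler_pdivlMr//; apply/andP; split; lra.
have [u cu] := choice ufcvg.
have ulin (a : R) x y : u (a *: x + y) = a * u x + u y.
  have c1 : (a * uf i x + uf i y) @[i --> G] --> a * u x + u y.
    by apply: cvgD => //; apply: cvgM => //; exact: cvg_cst.
  apply: (cvg_unique _ (cu _) _) => //.
  apply: cvg_trans c1; apply: near_eq_cvg; near=> i.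
  have [_ [li _] _] : feasible h C (zf i) (uf i) (bf i) by near: i.
  by rewrite li.
have du : dual u.
  apply: (@linear_bounded_dual _ _ _ V M) => // v Vv.
  by apply: (@ler_cvg_near _ _ G _ _ _ _ (cu v)); apply: filterS ufM => i; exact.
exists u; split=> //.
  have nC : \forall i \near G, C (zf i).1.
    by apply: filterS nfeas => i [].
  exact: (closed_cvg C Ccl nC _ cz1).
move=> y Cy.
(* By lower semicontinuity [a] stays below [h (zsub (zf i) (uf i)) <= bf i - uf i y], whose right
   side tends to [b - u y]. *)
have key (a : R) : (a%:E < h (zsub z u))%E -> a <= b - u y.
  move=> /(hlsc (zsub z u)) [W Wn Wh].
  have {}Wn : nbhs (zsub z u) [set w | Zset w -> W w].
    move: Wn; rewrite /nbhs /= -nbhs_subspace_in//; exact: Zset_zsub.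
  have cW : zsub (zf i) (uf i) @[i --> G] --> zsub z u.
    apply: (@cvg_pair _ _ _ G (nbhs z.1)
      (nbhs ((zsub z u).2 : {ptws X -> R}))) => //.
    by apply/pointwise_cvgP => x; apply: cvgB; [exact: cz2|exact: cu].
  have {}cW := cW _ Wn.
  rewrite -lerN2; apply: (@ler_cvg_near _ _ G _ (fun i => - (bf i - uf i y))).
    by apply: cvgN; apply: cvgB => //; exact: cu.
  near=> i; rewrite lerN2 -lee_fin.
  have [Ci di fi] : feasible h C (zf i) (uf i) (bf i) by near: i.
  have Zi : Zset (zf i) by near: i.
  apply: le_trans (fi _ Cy); apply/ltW/Wh.
  have : Zset (zsub (zf i) (uf i)) by exact: Zset_zsub.
  by near: i.
(* The level [b - u y + 1] rules out [+oo]; a real value [r] is approached by the levels [r - e]. *)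
case: (h (zsub z u)) key => [r|/(_ (b - u y + 1) (ltry _))|_] //; last first.
- by rewrite leNye.
- by rewrite gerDl ler10.
move=> key; rewrite lee_fin; apply/ler_addgt0Pr => e e0.
by have := key (r - e); rewrite lte_fin ltrBlDr ltrDl => /(_ e0); lra.
Unshelve. all: by end_near. Qed.

Lemma feasible_le h C z u (a b : R) : a <= b ->
  feasible h C z u a -> feasible h C z u b.
Proof.
move=> ab [Cz du fu]; split=> // y Cy; apply: le_trans (fu y Cy) _.
by rewrite lee_fin lerD2r.
Qed.

Lemma feasible_coupling h C z u (b : R) :
  (forall w, Zset w -> ((coupling w)%:E <= h w)%E) -> Zset z ->
  feasible h C z u b -> coupling z <= b.
Proof.
move=> hc Zz [Cz du fu].
have := le_trans (hc _ (Zset_zsub Zz du)) (fu _ Cz).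
by rewrite lee_fin /coupling /=; lra.
Qed.

Lemma coupling_le_inf_conv h C z :
  (forall w, Zset w -> ((coupling w)%:E <= h w)%E) -> Zset z ->
  ((coupling z)%:E <= inf_conv h C z)%E.
Proof.
move=> hc Zz; apply: le_ereal_inf_tmp => _ [b [u fu] <-].
by rewrite lee_fin; exact: feasible_coupling fu.
Qed.

Lemma inf_conv_le h C z u (b : R) :
  feasible h C z u b -> (inf_conv h C z <= b%:E)%E.
Proof. by move=> fu; apply: ereal_inf_lbound; exists b => //; exists u. Qed.

(** * Attainment, lower semicontinuity, convexity and the contact set *)

Section InteriorPoint.
Variables (h : Ztype X -> \bar R) (C : set X) (z0 : Ztype X).
Hypotheses (Ccl : closed C) (hconv : convex_on_Z h)
  (hlsc : lower_semicontinuous (h : subspace (@Zset R X) -> \bar R))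
  (hc : forall w, Zset w -> ((coupling w)%:E <= h w)%E)
  (Z0 : Zset z0) (h0 : (h z0 <= (coupling z0)%:E)%E) (C0 : nbhs z0.1 C).

(** [feasible_limit] with [z] fixed and the bounds [b + 1/(n+1)]. *)
Lemma inf_conv_attained z (b : R) : Zset z -> (inf_conv h C z <= b%:E)%E ->
  exists u, feasible h C z u b.
Proof.
move=> Zz kb.
have ex n : exists u, feasible h C z u (b + n.+1%:R^-1).
  have : (inf_conv h C z < (b + n.+1%:R^-1)%:E)%E.
    by apply: le_lt_trans kb _; rewrite lte_fin ltrDl invr_gt0.
  move=> /ereal_inf_lt[_ [a [u fu] <-]]; rewrite lte_fin => /ltW ab.
  by exists u; exact: feasible_le fu.
have [uf fuf] := choice ex.
apply: (@feasible_limit h C z0 nat \oo (fun=> z) uf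
  (fun n => b + n.+1%:R^-1)) => //.
- exact: nearW.
- exact: nearW.
- exact: cvg_cst.
- by move=> x; exact: cvg_cst.
- rewrite -[X in _ --> X]addr0; apply: cvgD; first exact: cvg_cst.
  exact: cvg_harmonic.
Qed.

(** Sublevel sets are closed: at a point adherent to one, [feasible_limit] along the trace of the
    neighbourhood filter keeps the bound [a]. *)
Lemma inf_conv_lsc :
  lower_semicontinuous (inf_conv h C : subspace (@Zset R X) -> \bar R).
Proof.
move=> zs a; pose z : Ztype X := zs; rewrite -[zs]/z => az.
have [Zz|nZz] := pselect (Zset z); last first.
  (* Points outside [Zset] are isolated in the subspace topology. *)
  exists [set z]; last by move=> _ ->.
  by rewrite /nbhs /= -nbhs_subspace_out//; exact: globally_filter.
pose B := [set w : Ztype X | Zset w /\ (inf_conv h C w <= a%:E)%E].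
suff nB : nbhs z (~` B).
  exists [set w | Zset w /\ ~ B w].
    rewrite /nbhs /= -nbhs_subspace_in//.
    by apply: filterS nB => w nBw Zw.
  by move=> w [Zw nBw]; rewrite ltNge; apply/negP => ?; exact: nBw.
apply: contrapT => nB.
have BP : ProperFilter (within B (nbhs z)).
  apply: Build_ProperFilter_ex => P PB; apply: contrapT => nP; apply: nB.
  have {}PB : nbhs z [set w | B w -> P w] by exact: PB.
  by apply: filterS PB => w /= PBw Bw; apply: nP; exists w; exact: PBw.
(* Off [B] the value [z.2] is a mere default that makes the choice function total. *)
have ex (w : Ztype X) : exists u, B w -> feasible h C w u a.
  have [[Zw kw]|nBw] := pselect (B w); last by exists z.2 => /nBw.
  by have [u fu] := inf_conv_attained Zw kw; exists u.
have [uf fuf] := choice ex.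
have cz : within B (nbhs z) --> nbhs z.
  exact: cvg_within.
have [u /inf_conv_le] : exists u, feasible h C z u a.
  apply: (@feasible_limit h C z0 (Ztype X) (within B (nbhs z))
    id uf (fun=> a)) => //.
  - by rewrite near_withinE; apply: nearW => w [].
  - by rewrite near_withinE; apply: nearW => w /fuf.
  - exact: (cvg_comp _ _ cz cvg_fst).
  - move=> x.
    have c2 : {ptws, (w.2 : {ptws X -> R}) @[w --> within B (nbhs z)] --> z.2}.
      exact: (cvg_comp _ _ cz cvg_snd).
    by move/pointwise_cvgP: c2 => /(_ x) c2 P /c2.
  - exact: cvg_cst.
by rewrite leNgt az.
Qed.

(** Attained functionals combine convexly: convexity of [h] is applied with the same [y] in both
    feasibility bounds. *)
Lemma inf_conv_convex : convex_set_X C -> convex_on_Z (inf_conv h C).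
Proof.
move=> Cconv z1 z2 a b t Z1 Z2 t01 k1 k2 /=.
have [u1 [Cz1 du1 f1]] := inf_conv_attained Z1 k1.
have [u2 [Cz2 du2 f2]] := inf_conv_attained Z2 k2.
apply: (@inf_conv_le _ _ _ (fun y => t * u1 y + (1 - t) * u2 y)).
split; [exact: Cconv|exact: dual_comb|move=> y Cy].
have := hconv (Zset_zsub Z1 du1) (Zset_zsub Z2 du2) t01 (f1 y Cy) (f2 y Cy).
move=> /=; congr (h _ <= _%:E)%E; last by ring.
by rewrite /zsub /=; congr pair; apply/funext => x; ring.
Qed.

(** An attained [u] splits [z.2] as [(z.2 - u) + u]: testing at [z.1] forces [h = c], hence the
    first part is in [A z.1]; testing at other [y] puts [u] in the normal cone. Conversely the
    normal part [g] is feasible with bound [coupling z]. *)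
Lemma inf_conv_eq_coupling (A : X -> set (X -> R)) :
  (forall x, A x `<=` @dual R X) ->
  [set z | Zset z /\ h z = (coupling z)%:E] = graph A ->
  [set z | Zset z /\ inf_conv h C z = (coupling z)%:E] =
    graph (op_add A (normal_cone C)).
Proof.
move=> Adual hA; apply/seteqP; split=> [z [Zz kz]|z].
  have /(inf_conv_attained Zz)[u [Cz du fu]] :
    (inf_conv h C z <= (coupling z)%:E)%E by rewrite kz.
  have Zu := Zset_zsub Zz du; have lo := hc Zu.
  exists (zsub z u).2.
    suff : graph A (zsub z u) by [].
    rewrite -hA; split=> //; apply/eqP; rewrite eq_le lo andbT.
    exact: fu.
  exists u; last by apply/funext => y; rewrite /= subrK.
  split=> //; split=> // y Cy.
  have := le_trans lo (fu y Cy); rewrite lee_fin /coupling /=.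
  by rewrite (dualD _ _ du) (dualN _ du); lra.
move=> [f Af [g [Cz [dg gle]] zE]].
have df := Adual _ _ Af.
have Zz : Zset z.
  rewrite /Zset /= zE; have := dual_comb 1 1 df dg.
  by congr dual; apply/funext => y; rewrite !mul1r.
have fE : zsub z g = (z.1, f).
  by rewrite /zsub zE; congr pair; apply/funext => y; rewrite addrK.
have [_ hf] : [set z | Zset z /\ h z = (coupling z)%:E] (z.1, f) by rewrite hA.
split=> //; apply/eqP; rewrite eq_le coupling_le_inf_conv// andbT.
apply: (@inf_conv_le h C z g); split=> // y Cy.
rewrite fE hf lee_fin /coupling /= zE.
by have := gle y Cy; rewrite (dualD _ _ dg) (dualN _ dg); lra.
Qed.

End InteriorPoint.

End Representative.

(** * Representability of the sum *)

Theorem theorem4p3 (R : realType) (X : tvsType R)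
  (Hhaus : hausdorff_space X) (Hnontriv : exists x : X, x != 0)
  (A : X -> set (X -> R)) (C : set X) :
  (forall x, A x `<=` @dual R X) ->
  representable A ->
  closed C -> convex_set_X C ->
  domain A `&` interior C !=set0 ->
  representable (op_add A (normal_cone C)).
Proof.
move=> Adual [h [_ [_ [hconv [hlsc [hc hA]]]]]] Ccl Cconv [x0 [[x0s Ax0] C0]].
pose z0 : Ztype X := (x0, x0s).
have [Z0 h0] : [set z | Zset z /\ h z = (coupling z)%:E] z0 by rewrite hA.
have {}h0 : (h z0 <= (coupling z0)%:E)%E by rewrite h0.
have Cx0 : nbhs z0.1 C by exact: C0.
have kc z : Zset z -> ((coupling z)%:E <= inf_conv h C z)%E.
  exact: coupling_le_inf_conv.
exists (inf_conv h C); split; last split; last split; last split; last split=> //.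
- exists z0 => //; apply: (@le_lt_trans _ _ (coupling z0)%:E); last exact: ltry.
  (* The zero functional is feasible at [z0], which gives properness. *)
  apply: (@inf_conv_le _ _ _ _ _ (fun=> 0)).
  split; [exact: nbhs_singleton|exact: dual_cst0|move=> y Cy].
  rewrite subr0; suff -> : zsub z0 (fun=> 0) = z0 by [].
  by rewrite /zsub /z0 /=; congr pair; apply/funext => x; rewrite subr0.
- by move=> z Zz; apply: lt_le_trans (kc z Zz); exact: ltNyr.
- exact: (inf_conv_convex Ccl hconv hlsc hc Z0 h0 Cx0).
- exact: (inf_conv_lsc Ccl hconv hlsc hc Z0 h0 Cx0).
- exact: (inf_conv_eq_coupling Ccl hconv hlsc hc Z0 h0 Cx0).
Qed.
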